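(* Let $A\in\mathbb{R}^{m\times n}$, $m\ge n$, have the SVD $A=U\begin{pmatrix}\Sigma\\ \mathbf{0}\end{pmatrix}V^T$ with $U=(u_1,\dots,u_m)$ and $V=(v_1,\dots,v_n)$ orthogonal and $\Sigma=\mathrm{diag}(\sigma_1,\dots,\sigma_n)$, $\sigma_1>\sigma_2>\cdots>\sigma_n>0$, and let $b\in\mathbb{R}^m$ with $u_i^Tb\neq 0$ for $i=1,\dots,n$. Assume that the problem $\min_x\|Ax-b\|$ is severely ill-posed, i.e. $\sigma_j=\mathcal{O}(\rho^{-j})$ with $\rho>1$, $j=1,2,\ldots,n$. Then $$\|\Delta_1\|\leq \frac{\sigma_{2}}{\sigma_1}\,\frac{\max_{2\leq i\leq n}|u_i^Tb|}{|u_1^Tb|}\left(1+\mathcal{O}(\rho^{-2})\right),$$ and, for $k=2,3,\ldots,n-1$, $$\|\Delta_k\|\leq \frac{\sigma_{k+1}}{\sigma_k}\,\frac{\max_{k+1\leq i\leq n}|u_i^Tb|}{\min_{1\leq i\leq k}|u_i^Tb|}\left(1+\mathcal{O}(\rho^{-2})\right)|L_{k_1}^{(k)}(0)|,$$ where $$|L_{k_1}^{(k)}(0)|=\max_{j=1,2,\ldots,k}|L_j^{(k)}(0)|,\qquad |L_j^{(k)}(0)|=\prod_{i=1,\,i\ne j}^k\frac{\sigma_i^2}{|\sigma_j^2-\sigma_i^2|},\quad j=1,2,\ldots,k.$$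
   Context: $\|\cdot\|$ is the 2-norm of a vector or the spectral norm of a matrix. Definition of $\Delta_k$ ($1\le k\le n-1$): let $D=\mathrm{diag}(\sigma_1u_1^Tb,\dots,\sigma_nu_n^Tb)\in\mathbb{R}^{n\times n}$ and let $T_k\in\mathbb{R}^{n\times k}$ be the matrix with $(i,l)$ entry $\sigma_i^{2(l-1)}$. Partition $D=\mathrm{diag}(D_1,D_2)$ and $T_k=\begin{pmatrix} T_{k1} \\ T_{k2} \end{pmatrix}$ with $D_1,T_{k1}\in\mathbb{R}^{k\times k}$; $T_{k1}$ is a nonsingular Vandermonde matrix. Then $\Delta_k=D_2T_{k2}T_{k1}^{-1}D_1^{-1}\in\mathbb{R}^{(n-k)\times k}$. (Then $\|\tan\Theta(\mathcal{V}_k,\mathcal{V}_k^R)\|=\|\Delta_k\|$, where $\mathcal{V}_k=\mathrm{span}\{v_1,\dots,v_k\}$, $\mathcal{V}_k^R=\mathrm{span}\{A^Tb,(A^TA)A^Tb,\dots,(A^TA)^{k-1}A^Tb\}$, and $\Theta$ denotes the canonical angles between the two subspaces.) Meaning of the order notation: $\sigma_j=\mathcal{O}(\rho^{-j})$, $j=1,\dots,n$, is understood in the two-sided sense that there are constants $c_2\ge c_1>0$ with $c_1\rho^{-j}\le\sigma_j\le c_2\rho^{-j}$ for all $j$. A factor $1+\mathcal{O}(\rho^{-2})$ in an upper bound means a factor not larger than $1+C\rho^{-2}$, where $C$ depends only on $c_1,c_2$ and on a lower bound $\rho_0>1$ for $\rho$ (in particular not on $n$, $k$ or $b$). *)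

(* Defs.v *)
From HB Require Import structures.
From mathcomp Require Import all_boot all_order all_algebra.
From mathcomp Require Import mathcomp_extra boolp classical_sets reals.

Set Implicit Arguments.
Unset Strict Implicit.
Unset Printing Implicit Defensive.

Import Order.TTheory GRing.Theory Num.Theory.

Local Open Scope classical_set_scope.
Local Open Scope ring_scope.

(* The normed structure that MathComp-Analysis puts on matrices is the
   max-norm, so the Euclidean norm and the operator norm it induces (the
   spectral norm) are defined here. *)
Definition norm2 (R : realType) (n : nat) (x : 'cV[R]_n) : R :=
  Num.sqrt (\sum_(i < n) x i 0 ^+ 2).

Definition spectral_norm (R : realType) (m n : nat) (M : 'M[R]_(m, n)) : R :=
  sup [set norm2 (M *m x) | x in [set x : 'cV[R]_n | norm2 x <= 1]].

(* Indices are ordinals, hence 0-based: the value of [sigma] (or [beta]) at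
   the ordinal i is the (i+1)-st singular value (coefficient). *)

(* The m x n block matrix with diag(sigma) on top of a zero block. *)
Definition Sigma_mx (R : realType) (m n : nat) (sigma : 'I_n -> R) :
    'M[R]_(m, n) :=
  \matrix_(i < m, j < n) (sigma j *+ (i == j :> nat)).

Definition is_SVD (R : realType) (m n : nat) (A : 'M[R]_(m, n))
    (U : 'M[R]_m) (sigma : 'I_n -> R) (V : 'M[R]_n) : Prop :=
  [/\ U^T *m U = 1%:M, V^T *m V = 1%:M
    & A = U *m Sigma_mx m sigma *m V^T].

(* u_{i+1}^T b, for i < n <= m. *)
Definition ucoef (R : realType) (m n : nat) (hmn : (n <= m)%N)
    (U : 'M[R]_m) (b : 'cV[R]_m) (i : 'I_n) : R :=
  ((col (widen_ord hmn i) U)^T *m b) 0 0.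

(* sigma_j = O(rho^-j) for j = 1..n, two-sided with explicit constants. *)
Definition severely_ill_posed (R : realType) (n : nat) (sigma : 'I_n -> R)
    (c1 c2 rho : R) : Prop :=
  forall j : 'I_n, c1 * rho ^- j.+1 <= sigma j /\ sigma j <= c2 * rho ^- j.+1.

Section Delta.
Variables (R : realType) (n k : nat) (hk : (k <= n)%N).
Variables (sigma beta : 'I_n -> R).

Definition Dmx : 'M[R]_n := diag_mx (\row_(i < n) (sigma i * beta i)).

Definition Tmx : 'M[R]_(n, k) :=
  \matrix_(i < n, l < k) sigma i ^+ (2 * l).

(* The partition is along n = k + (n - k). *)
Let e : n = (k + (n - k))%N := esym (subnKC hk).
Let Dblock : 'M[R]_(k + (n - k)) := castmx (e, e) Dmx.
Let Tblock : 'M[R]_(k + (n - k), k) := castmx (e, erefl k) Tmx.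

Definition Delta : 'M[R]_(n - k, k) :=
  drsubmx Dblock *m dsubmx Tblock *m invmx (usubmx Tblock)
    *m invmx (ulsubmx Dblock).
End Delta.

(* |L_{j+1}^{(k)}(0)| *)
Definition absL0 (R : realType) (n : nat) (sigma : 'I_n -> R) (k : nat)
    (j : 'I_n) : R :=
  \prod_(i < n | (i < k)%N && (i != j))
    (sigma i ^+ 2 / `|sigma j ^+ 2 - sigma i ^+ 2|).

(* The maximum of |L_j^{(k)}(0)| over j = 1..k; all terms are nonnegative, so
   the neutral element 0 does not affect it when k > 0. *)
Definition max_absL0 (R : realType) (n : nat) (sigma : 'I_n -> R) (k : nat) :
    R :=
  \big[Num.max/0]_(j < n | (j < k)%N) absL0 sigma k j.

(* The maximum of |beta_i| over the (1-based) indices i = k+1..n. *)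
Definition max_tail (R : realType) (n : nat) (beta : 'I_n -> R) (k : nat) : R :=
  \big[Num.max/0]_(i < n | (k <= i)%N) `|beta i|.

(* The minimum of |beta_i| over the (1-based) indices i = 1..k, for
   0 < k < n.  The term at 0-based index k-1, which is in the range, serves as
   the initial value of the iterated minimum. *)
Definition ord_before (n k : nat) (hk : (k < n)%N) : 'I_n :=
  Ordinal (leq_ltn_trans (leq_pred k) hk).

Definition min_head (R : realType) (n : nat) (beta : 'I_n -> R) (k : nat)
    (hk : (k < n)%N) : R :=
  \big[Num.min/`|beta (ord_before hk)|]_(i < n | (i < k)%N) `|beta i|.

(* Main.v *)
Require Import Defs.
From HB Require Import structures.
From mathcomp Require Import all_boot all_order all_algebra.
From mathcomp Require Import mathcomp_extra boolp classical_sets reals.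
From mathcomp Require Import ring lra.

Set Implicit Arguments.
Unset Strict Implicit.
Unset Printing Implicit Defensive.

Import Order.TTheory GRing.Theory Num.Theory.

Local Open Scope ring_scope.

(** Write [s l] for [sigma l ^+ 2].  The inverse of the Vandermonde matrix of
    the first [k] nodes has the coefficients of their Lagrange polynomials as
    columns, so the entry of Delta_k in tail row [i] and head column [j] is
    [(sigma i * beta i) / (sigma j * beta j)] times the [j]-th Lagrange
    polynomial at [s i] ([DeltaE]).  As [s i] lies between 0 and every node,
    this value is, in absolute value, at most the one at 0, that is [absL0] at
    [j] ([lagrange_poly_tail_le]).  Hence
    [`|Delta_k i j| <= (max |beta| / min |beta|) * max_absL0 * sigma i / sigma j].
    The right-hand side is a matrix of rank one, and the product of the lengths
    of its two vectors bounds the norm of Delta_k ([spectral_norm_rank1_le]).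
    Taking out sigma_(k+1) and 1 / sigma_k, there remain the square roots of
    [\sum_(i > k) (sigma_i / sigma_(k+1)) ^+ 2] and
    [\sum_(j <= k) (sigma_k / sigma_j) ^+ 2] (1-based indices).  Each sum
    contains one term 1, and its other terms are at most [(c2 / c1) ^+ 2] times
    the successive powers of [rho ^- 2]; so each is at most [1 + C * rho ^- 2]
    with [C = (c2 / c1) ^+ 2 / (1 - rho0 ^- 2)] ([sum_tail_le],
    [sum_head_le]), and so is the square root of their product.

    The case [k = 1] is the instance of this bound where the only Lagrange
    polynomial is the constant 1. *)

(** * Spectral norms of matrices with rank-one domination *)

(** Lagrange's identity: the difference of the two sides is half of the sum of
    the squares [(a i * x j - a j * x i) ^+ 2]. *)
Lemma sum_cauchy_schwarz (R : realFieldType) (n : nat) (a x : 'I_n -> R) :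
  (\sum_i a i * x i) ^+ 2 <= (\sum_i a i ^+ 2) * (\sum_i x i ^+ 2).
Proof.
have : 0 <= \sum_i \sum_j (a i * x j - a j * x i) ^+ 2.
  by apply: sumr_ge0 => i _; apply: sumr_ge0 => j _; apply: sqr_ge0.
have -> : \sum_i \sum_j (a i * x j - a j * x i) ^+ 2 =
    \sum_i \sum_j a i ^+ 2 * x j ^+ 2 + \sum_i \sum_j a j ^+ 2 * x i ^+ 2
    - 2 * \sum_i \sum_j (a i * x i) * (a j * x j).
  rewrite mulr_sumr -big_split -sumrB /=; apply: eq_bigr => i _.
  rewrite mulr_sumr -big_split -sumrB /=; apply: eq_bigr => j _.
  ring.
rewrite [X in _ + X - _]exchange_big /= -!big_distrlr /= expr2; lra.
Qed.

Lemma norm2_ge0 (R : realType) (n : nat) (x : 'cV[R]_n) : 0 <= norm2 x.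
Proof. exact: sqrtr_ge0. Qed.

Lemma sqr_norm2 (R : realType) (n : nat) (x : 'cV[R]_n) :
  norm2 x ^+ 2 = \sum_i x i 0 ^+ 2.
Proof. by rewrite sqr_sqrtr // sumr_ge0 // => i _; apply: sqr_ge0. Qed.

Lemma spectral_norm_le (R : realType) (m n : nat) (M : 'M[R]_(m, n)) (t : R) :
  (forall x : 'cV[R]_n, norm2 x <= 1 -> norm2 (M *m x) <= t) ->
  spectral_norm M <= t.
Proof.
move=> Mt; apply: ge_sup => [|_ [x /= x1 <-]]; last exact: Mt.
exists (norm2 (M *m 0)); exists 0 => //=.
by rewrite /norm2 big1 ?sqrtr0 ?ler01 // => i _; rewrite mxE expr0n.
Qed.

(** By Cauchy-Schwarz, row [i] of [M] applied to a vector of length at most 1 is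
    at most [p i] times the length of [q] in absolute value. *)
Lemma spectral_norm_rank1_le (R : realType) (m n : nat) (M : 'M[R]_(m, n))
    (p : 'I_m -> R) (q : 'I_n -> R) (t : R) :
  0 <= t -> (forall i j, `|M i j| <= p i * q j) ->
  (\sum_i p i ^+ 2) * (\sum_j q j ^+ 2) <= t ^+ 2 ->
  spectral_norm M <= t.
Proof.
move=> t0 Mpq pqt; apply: spectral_norm_le => x x1.
rewrite -ler_sqr ?nnegrE ?norm2_ge0 // sqr_norm2; apply: le_trans pqt.
have x1' : \sum_j x j 0 ^+ 2 <= 1 by rewrite -sqr_norm2 expr_le1 ?norm2_ge0.
rewrite mulr_suml; apply: ler_sum => i _; rewrite mxE.
apply: (le_trans (sum_cauchy_schwarz _ _)).
have Mi : \sum_j M i j ^+ 2 <= p i ^+ 2 * \sum_j q j ^+ 2.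
  rewrite mulr_sumr; apply: ler_sum => j _.
  rewrite -exprMn -[leLHS]real_normK ?num_real //.
  have pq0 := le_trans (normr_ge0 _) (Mpq i j).
  by rewrite ler_sqr ?nnegrE.
apply: le_trans Mi; apply: ler_piMr => //.
by apply: sumr_ge0 => j _; apply: sqr_ge0.
Qed.

(** * Lagrange interpolation and Vandermonde matrices *)

Definition lagrange_poly (F : fieldType) (k : nat) (s : 'I_k -> F) (j : 'I_k) :
    {poly F} :=
  \prod_(i < k | i != j) ((s j - s i)^-1 *: ('X - (s i)%:P)).

Lemma horner_lagrange_poly (F : fieldType) (k : nat) (s : 'I_k -> F) j x :
  (lagrange_poly s j).[x] = \prod_(i < k | i != j) ((x - s i) / (s j - s i)).
Proof.
rewrite horner_prod; apply: eq_bigr => i _.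
by rewrite hornerZ hornerXsubC mulrC.
Qed.

Lemma size_lagrange_poly (F : fieldType) (k : nat) (s : 'I_k -> F) j :
  (size (lagrange_poly s j) <= k)%N.
Proof.
apply: leq_trans (size_poly_prod_leq _ _) _.
have szle : (\sum_(i < k | i != j)
    size ((s j - s i)^-1 *: ('X - (s i)%:P)) <= \sum_(i < k | i != j) 2)%N.
  by apply: leq_sum => i _; rewrite (leq_trans (size_scale_leq _ _)) ?size_XsubC.
rewrite leq_subLR (leq_ltn_trans szle) // sum_nat_const cardC1 card_ord.
by case: k s j {szle} => [|k] s [] //= *; rewrite muln2 -addnn addnS ltnS.
Qed.

Definition vandermonde_rows (F : fieldType) (p k : nat) (x : 'I_p -> F) :
    'M[F]_(p, k) :=
  \matrix_(i < p, l < k) x i ^+ l.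

(** The coefficients of the Lagrange polynomials of [s] are the columns of the
    inverse of the Vandermonde matrix of [s], so multiplying by this inverse
    evaluates the Lagrange polynomials. *)
Lemma vandermonde_rows_mulVmx (F : fieldType) (p k : nat) (s : 'I_k -> F)
    (x : 'I_p -> F) :
  injective s ->
  vandermonde_rows k x *m invmx (vandermonde_rows k s) =
  \matrix_(i, j) (lagrange_poly s j).[x i].
Proof.
move=> s_inj.
pose C := \matrix_(l < k, j < k) (lagrange_poly s j)`_l.
have evalC p' (y : 'I_p' -> F) :
    vandermonde_rows k y *m C = \matrix_(i, j) (lagrange_poly s j).[y i].
  apply/matrixP => i j; rewrite !mxE (horner_coef_wide _ (size_lagrange_poly _ _)).
  by apply: eq_bigr => l _; rewrite !mxE mulrC.
have VC : vandermonde_rows k s *m C = 1%:M.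
  rewrite evalC; apply/matrixP => i j; rewrite !mxE horner_lagrange_poly.
  case: eqVneq => [->|ij].
    by rewrite big1 // => l lj; rewrite divff // subr_eq0 inj_eq // eq_sym.
  by rewrite (bigD1 i) //= subrr mul0r mul0r.
have [Vu _] := mulmx1_unit VC.
by rewrite -[invmx _]mulmx1 -VC [X in _ *m X]mulKmx // evalC.
Qed.

(** * Closed form of Delta *)

Section DeltaEntries.
Variables (R : realType) (n k : nat) (hk : (k <= n)%N).

Definition head_ord (j : 'I_k) : 'I_n := widen_ord hk j.

Definition tail_ord (i : 'I_(n - k)) : 'I_n :=
  cast_ord (subnKC hk) (rshift k i).

Lemma head_ord_inj : injective head_ord.
Proof. by move=> i j /(congr1 val) /= /val_inj. Qed.

Variables (sigma beta : 'I_n -> R).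
Hypothesis sigma_inj : injective (fun i => sigma i ^+ 2).
Hypothesis sigma_neq0 : forall i, sigma i != 0.
Hypothesis beta_neq0 : forall i, beta i != 0.

(** The factors [D_1] and [D_2] scale the columns and rows of the product of
    Vandermonde matrices given by [vandermonde_rows_mulVmx]. *)
Lemma DeltaE i j :
  Delta hk sigma beta i j =
  sigma (tail_ord i) * beta (tail_ord i)
  * (lagrange_poly (fun l => sigma (head_ord l) ^+ 2) j).[sigma (tail_ord i) ^+ 2]
  / (sigma (head_ord j) * beta (head_ord j)).
Proof.
rewrite /Delta.
set D := castmx _ (Dmx sigma beta); set T := castmx _ (Tmx k sigma).
pose d l := sigma l * beta l.
have cast_l l : cast_ord (subnKC hk) (lshift (n - k) l) = head_ord l.
  exact: val_inj.
have D2E : drsubmx D = diag_mx (\row_l d (tail_ord l)).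
  apply/matrixP => a c; rewrite !mxE castmxE !mxE /= !esymK.
  by rewrite (inj_eq (@cast_ord_inj _ _ _)) (inj_eq (@rshift_inj _ _)).
have D1E : ulsubmx D = diag_mx (\row_l d (head_ord l)).
  apply/matrixP => a c; rewrite !mxE castmxE !mxE /= !esymK !cast_l.
  by rewrite (inj_eq head_ord_inj).
have T2E : dsubmx T = vandermonde_rows k (fun l => sigma (tail_ord l) ^+ 2).
  apply/matrixP => a c; rewrite !mxE castmxE !mxE /= !esymK.
  by rewrite exprM.
have T1E : usubmx T = vandermonde_rows k (fun l => sigma (head_ord l) ^+ 2).
  apply/matrixP => a c; rewrite !mxE castmxE !mxE /= !esymK cast_l.
  by rewrite exprM.
have D1V : invmx (ulsubmx D) = diag_mx (\row_l (d (head_ord l))^-1).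
  have D1D : ulsubmx D *m diag_mx (\row_l (d (head_ord l))^-1) = 1%:M.
    rewrite D1E mulmx_diag -diag_const_mx; congr diag_mx.
    by apply/rowP => l; rewrite !mxE divff // mulf_neq0.
  have [D1u _] := mulmx1_unit D1D.
  by rewrite -[LHS]mulmx1 -D1D mulKmx.
rewrite D1V D2E T2E T1E -[X in (X *m _) i j]mulmxA vandermonde_rows_mulVmx; last first.
  by move=> a c /sigma_inj /head_ord_inj.
by rewrite mul_mx_diag mxE mul_diag_mx !mxE.
Qed.

End DeltaEntries.

(** The tail value lies between 0 and every node: for a tail index [i] and a
    head index [l], [0 <= sigma l ^+ 2 - sigma i ^+ 2 <= sigma l ^+ 2], so each
    factor of the Lagrange polynomial is largest at 0 in absolute value. *)
Lemma lagrange_poly_tail_le (R : realType) (n k : nat) (hk : (k <= n)%N)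
    (sigma : 'I_n -> R) (i : 'I_(n - k)) (j : 'I_k) :
  (forall a c : 'I_n, (a < c)%N -> sigma c < sigma a) ->
  (forall a : 'I_n, 0 < sigma a) ->
  `|(lagrange_poly (fun l => sigma (head_ord hk l) ^+ 2) j).[sigma (tail_ord hk i) ^+ 2]|
  <= absL0 sigma k (head_ord hk j).
Proof.
move=> sdec spos; rewrite horner_lagrange_poly normr_prod /absL0.
under [leRHS]eq_bigl => a do rewrite andbC.
rewrite big_ord_narrow_cond [leRHS](eq_bigl (fun l => l != j)); last first.
  by move=> l; rewrite (inj_eq (@head_ord_inj _ _ hk)).
apply: ler_prod => l lj; rewrite normr_ge0 /= normf_div.
apply: ler_wpM2r; first by rewrite invr_ge0.
have lt_s : sigma (tail_ord hk i) < sigma (head_ord hk l).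
  by apply: sdec; rewrite /= (leq_trans (ltn_ord l)) ?leq_addr.
have := spos (tail_ord hk i).
rewrite ler_norml; nra.
Qed.

(** * Geometric decay *)

(** The first term is kept apart from the geometric bound: this is what turns
    the constant [kappa] into a factor [1 + O(r)]. *)
Lemma sum_geometric_le (R : realFieldType) (N : nat) (f : 'I_N -> R)
    (kappa r r0 : R) :
  0 <= kappa -> 0 <= r <= r0 -> r0 < 1 ->
  (forall i : 'I_N, i = 0%N :> nat -> f i <= 1) ->
  (forall i, f i <= kappa * r ^+ i) ->
  \sum_i f i <= 1 + kappa / (1 - r0) * r.
Proof.
move=> kappa0 /andP[r_ge0 rr0] r01 f1 fr.
have r01' : 0 < 1 - r0 by rewrite subr_gt0.
have K0 : 0 <= kappa / (1 - r0) * r.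
  by apply: mulr_ge0 => //; apply: divr_ge0 => //; exact: ltW.
case: N => [|N] in f f1 fr *; first by rewrite big_ord0; lra.
rewrite big_ord_recl lerD ?f1 //.
have le_geo : \sum_(i < N) f (lift ord0 i) <= kappa * r * \sum_(i < N) r ^+ i.
  rewrite mulr_sumr; apply: ler_sum => i _.
  by rewrite -mulrA -exprS; exact: fr.
apply: (le_trans le_geo).
rewrite [leRHS]mulrAC; apply: ler_wpM2l; first exact: mulr_ge0.
rewrite -[leRHS]mul1r ler_pdivlMr //.
have S0 : 0 <= \sum_(i < N) r ^+ i by apply: sumr_ge0 => i _; apply: exprn_ge0.
have := subrX1 r N; have := exprn_ge0 N r_ge0; nra.
Qed.

Section SeverelyIllPosed.
Variables (R : realType) (n : nat) (sigma : 'I_n -> R) (c1 c2 rho0 rho : R).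
Hypotheses (hc1 : 0 < c1) (hc12 : c1 <= c2) (hrho0 : 1 < rho0).
Hypotheses (hrho : rho0 <= rho) (hill : severely_ill_posed sigma c1 c2 rho).
Hypothesis sigma_gt0 : forall i, 0 < sigma i.

Let rho0_gt0 : 0 < rho0. Proof. exact: lt_trans hrho0. Qed.

Let rho_gt0 : 0 < rho. Proof. exact: lt_le_trans hrho. Qed.

Let c2_gt0 : 0 < c2. Proof. exact: lt_le_trans hc12. Qed.

(** Both sides of the two-sided decay are used, the upper one for [sigma c] and
    the lower one for [sigma a]; the quotient depends on [c - a] only. *)
Lemma sqr_ratio_le (a c : 'I_n) : (a <= c)%N ->
  (sigma c / sigma a) ^+ 2 <= (c2 / c1) ^+ 2 * (rho ^- 2) ^+ (c - a).
Proof.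
move=> ac.
have [alo _] := hill a; have [_ chi] := hill c.
rewrite -exprVn -exprM mulnC exprM -exprMn ler_sqr ?nnegrE; last first.
- by rewrite mulr_ge0 ?divr_ge0 ?exprn_ge0 ?invr_ge0 ?ltW.
- by rewrite divr_ge0 ?ltW.
rewrite ler_pdivrMr //; apply: (le_trans chi).
have -> : c2 * rho ^- c.+1 = c2 / c1 * rho^-1 ^+ (c - a) * (c1 * rho ^- a.+1).
  rewrite -[in LHS](subnK ac) -addnS -!exprVn exprD.
  by field; rewrite gt_eqF.
apply: ler_wpM2l => //.
by rewrite mulr_ge0 ?divr_ge0 ?exprn_ge0 ?invr_ge0 ?ltW.
Qed.

(** The constant given by [sum_geometric_le] for the ratio [rho ^- 2], which
    is at most [rho0 ^- 2], and for the constant of [sqr_ratio_le]. *)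
Let C := (c2 / c1) ^+ 2 / (1 - rho0 ^- 2).

Let rho2_bounds : 0 <= rho ^- 2 <= rho0 ^- 2.
Proof.
apply/andP; split; first by rewrite invr_ge0 exprn_ge0 // ltW.
by rewrite lef_pV2 ?posrE ?exprn_gt0 // ler_sqr ?nnegrE // ltW.
Qed.

Let rho02_lt1 : rho0 ^- 2 < 1.
Proof. by rewrite invf_lt1 ?exprn_gt0 // exprn_egt1. Qed.

Lemma sum_tail_le (k : nat) (hk : (k < n)%N) :
  \sum_i (sigma (tail_ord (ltnW hk) i) / sigma (Ordinal hk)) ^+ 2
  <= 1 + C * rho ^- 2.
Proof.
apply: sum_geometric_le => //; first exact: sqr_ge0.
- move=> i i0.
  have -> : tail_ord (ltnW hk) i = Ordinal hk.
    by apply: val_inj; rewrite /= i0 addn0.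
  by rewrite divff ?expr1n // gt_eqF.
- move=> i; have := @sqr_ratio_le (Ordinal hk) (tail_ord (ltnW hk) i).
  by rewrite /= addKn; apply; rewrite leq_addr.
Qed.

Lemma sum_head_le (k : nat) (hk : (k < n)%N) :
  \sum_j (sigma (ord_before hk) / sigma (head_ord (ltnW hk) j)) ^+ 2
  <= 1 + C * rho ^- 2.
Proof.
(* Reversed, the sum starts with the term 1 of the last head index. *)
rewrite (reindex_inj rev_ord_inj) /=.
apply: sum_geometric_le => //; first exact: sqr_ge0.
- move=> j j0.
  have -> : head_ord (ltnW hk) (rev_ord j) = ord_before hk.
    by apply: val_inj; rewrite /= j0 subn1.
  by rewrite divff ?expr1n // gt_eqF.
- move=> j; have := @sqr_ratio_le (head_ord (ltnW hk) (rev_ord j)) (ord_before hk).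
  have -> : (ord_before hk - head_ord (ltnW hk) (rev_ord j))%N = j.
    by rewrite /= -subn1 -subnDA add1n -subSn // subSS subKn // ltnW.
  by apply; rewrite /= -subn1 leq_sub2l.
Qed.

(** * The bound for a general number of nodes *)

Section DeltaBound.
Variable beta : 'I_n -> R.
Hypothesis sigma_decr : forall i j : 'I_n, (i < j)%N -> sigma j < sigma i.
Hypothesis beta_neq0 : forall i, beta i != 0.

Lemma sqr_sigma_inj : injective (fun i => sigma i ^+ 2).
Proof.
have neq_sqr (i j : 'I_n) : (i < j)%N -> sigma i ^+ 2 != sigma j ^+ 2.
  move=> /sigma_decr ij; rewrite gt_eqF // ltr_sqr ?nnegrE //; exact: ltW.
move=> i j /= sij; apply: val_inj => /=.
by have [/neq_sqr|/neq_sqr|//] := ltngtP i j; rewrite sij eqxx.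
Qed.

Lemma min_head_gt0 (k : nat) (hk : (k < n)%N) : 0 < min_head beta hk.
Proof. by apply: lt_bigmin => [|i _]; rewrite normr_gt0. Qed.

(** The sums over tail and head are normalised by [sigma (Ordinal hk)] and
    [sigma (ord_before hk)], the largest tail and the smallest head value, so
    that each contributes a factor [1 + C * rho ^- 2] to the squared norm. *)
Lemma spectral_norm_Delta_le (k : nat) (hk : (k < n)%N) :
  spectral_norm (Delta (ltnW hk) sigma beta)
  <= sigma (Ordinal hk) / sigma (ord_before hk)
     * (max_tail beta k / min_head beta hk)
     * (1 + C * rho ^- 2) * max_absL0 sigma k.
Proof.
set B := max_tail beta k / _; set L := max_absL0 sigma k.
set K := 1 + C * rho ^- 2.
have mh0 := min_head_gt0 hk.
have B0 : 0 <= B by rewrite divr_ge0 ?(ltW mh0) // bigmax_ge_id.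
have L0 : 0 <= L by apply: bigmax_ge_id.
have K0 : 0 <= K.
  apply: le_trans (sum_tail_le hk); apply: sumr_ge0 => i _; exact: sqr_ge0.
pose t := sigma (Ordinal hk) / sigma (ord_before hk) * B * L.
have t0 : 0 <= t.
  by apply: mulr_ge0 => //; apply: mulr_ge0 => //; rewrite divr_ge0 // ltW.
rewrite mulrAC -/t.
apply: (@spectral_norm_rank1_le _ _ _ _
  (fun i => sigma (tail_ord (ltnW hk) i) / sigma (Ordinal hk))
  (fun j => t * (sigma (ord_before hk) / sigma (head_ord (ltnW hk) j)))).
- exact: mulr_ge0.
- move=> i j; rewrite DeltaE //; last first.
  + by move=> a; rewrite gt_eqF.
  + exact: sqr_sigma_inj.
  set si := sigma (tail_ord _ i); set sj := sigma (head_ord _ j).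
  set bi := beta (tail_ord _ i); set bj := beta (head_ord _ j).
  have sigma_neq0 a : sigma a != 0 by rewrite gt_eqF.
  have [sj0 bj0] : sj != 0 /\ bj != 0.
    by split; [exact: sigma_neq0 | exact: beta_neq0].
  set Lij := (lagrange_poly _ j).[_].
  have LijL : `|Lij| <= L.
    apply: le_trans (lagrange_poly_tail_le _ i j _ _) _ => //.
    by apply: (le_bigmax_cond _ (absL0 sigma k)); rewrite /= ltn_ord.
  have bB : `|bi / bj| <= B.
    rewrite normf_div ler_pM ?invr_ge0 //.
      by apply: (le_bigmax_cond _ (fun i => `|beta i|)); rewrite /= leq_addr.
    rewrite lef_pV2 ?posrE ?normr_gt0 ?beta_neq0 //.
    by apply: (bigmin_le_cond _ (fun i => `|beta i|)); rewrite /= ltn_ord.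
  have -> : si * bi * Lij / (sj * bj) = si / sj * (bi / bj * Lij).
    by field; rewrite bj0 sj0.
  have -> : si / sigma (Ordinal hk) * (t * (sigma (ord_before hk) / sj)) =
      si / sj * (B * L).
    by rewrite /t; field; rewrite sj0 !sigma_neq0.
  have ss0 : 0 <= si / sj by rewrite divr_ge0 // ltW // sigma_gt0.
  rewrite normrM (ger0_norm ss0); apply: ler_wpM2l => //.
  by rewrite normrM ler_pM.
- have -> : \sum_j (t * (sigma (ord_before hk) / sigma (head_ord (ltnW hk) j))) ^+ 2 =
      t ^+ 2 * \sum_j (sigma (ord_before hk) / sigma (head_ord (ltnW hk) j)) ^+ 2.
    by rewrite mulr_sumr; apply: eq_bigr => j _; rewrite exprMn.
  rewrite mulrCA [leRHS]exprMn; apply: ler_wpM2l; first exact: sqr_ge0.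
  rewrite expr2 ler_pM ?sum_tail_le ?sum_head_le //.
  + by apply: sumr_ge0 => i _; exact: sqr_ge0.
  + by apply: sumr_ge0 => j _; exact: sqr_ge0.
Qed.

End DeltaBound.

End SeverelyIllPosed.

(** * The case of one node *)

(** The product over the other nodes is empty. *)
Lemma max_absL0_1 (R : realType) (n : nat) (sigma : 'I_n -> R) :
  (0 < n)%N -> max_absL0 sigma 1 = 1.
Proof.
case: n sigma => // n sigma _.
rewrite /max_absL0 (bigD1 ord0) //= big1_idem; first last.
- by move=> i; rewrite ltnS leqn0 => /andP[/eqP i0 /eqP[]]; apply: val_inj.
- exact: maxxx.
rewrite /absL0 big1 ?max_l // => i.
by rewrite ltnS leqn0 => /andP[/eqP i0 /eqP[]]; apply: val_inj.
Qed.

Lemma min_head_1 (R : realType) (n : nat) (beta : 'I_n -> R) (h1 : (1 < n)%N) :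
  min_head beta h1 = `|beta (Ordinal (ltnW h1))|.
Proof.
have before1 : ord_before h1 = Ordinal (ltnW h1) by apply: val_inj.
rewrite /min_head before1.
apply/le_anti; rewrite bigmin_le_id /=; apply: le_bigmin => // i.
rewrite ltnS leqn0 => /eqP i0.
by have -> : i = Ordinal (ltnW h1) by apply: val_inj.
Qed.

Theorem theorem4p2 (R : realType) (c1 c2 rho0 : R)
    (hc1 : 0 < c1) (hc12 : c1 <= c2) (hrho0 : 1 < rho0) :
  exists C : R, 0 < C /\
    forall (m n : nat) (hmn : (n <= m)%N)
           (A : 'M[R]_(m, n)) (U : 'M[R]_m) (sigma : 'I_n -> R) (V : 'M[R]_n)
           (b : 'cV[R]_m) (rho : R),
      is_SVD A U sigma V ->
      (forall i j : 'I_n, (i < j)%N -> sigma j < sigma i) ->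
      (forall i : 'I_n, 0 < sigma i) ->
      (forall i : 'I_n, ucoef hmn U b i != 0) ->
      rho0 <= rho ->
      severely_ill_posed sigma c1 c2 rho ->
      let beta := ucoef hmn U b in
      (forall h1 : (1 < n)%N,
          spectral_norm (Delta (ltnW h1) sigma beta)
          <= sigma (Ordinal h1) / sigma (Ordinal (ltnW h1))
             * (max_tail beta 1 / `|beta (Ordinal (ltnW h1))|)
             * (1 + C * rho ^- 2))
      /\
      (forall (k : nat) (hk : (k < n)%N), (2 <= k)%N ->
          spectral_norm (Delta (ltnW hk) sigma beta)
          <= sigma (Ordinal hk) / sigma (ord_before hk)
             * (max_tail beta k / min_head beta hk)
             * (1 + C * rho ^- 2)
             * max_absL0 sigma k).
Proof.
exists ((c2 / c1) ^+ 2 / (1 - rho0 ^- 2)); split.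
  have rho0_gt0 : 0 < rho0 by apply: lt_trans hrho0.
  have c2_gt0 : 0 < c2 by apply: lt_le_trans hc12.
  by rewrite divr_gt0 ?exprn_gt0 ?divr_gt0 ?subr_gt0 ?invf_lt1 ?exprn_egt1 ?exprn_gt0.
move=> m n hmn A U sigma V b rho _ sdec spos bneq0 hrho hill beta.
have main k (hk : (k < n)%N) :=
  spectral_norm_Delta_le hc1 hc12 hrho0 hrho hill spos sdec bneq0 hk.
split=> [h1|k hk _]; last exact: main.
have := main 1 h1; rewrite max_absL0_1 ?mulr1 ?(ltnW h1) // min_head_1.
by have -> : ord_before h1 = Ordinal (ltnW h1) by apply: val_inj.
Qed.
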